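(* For any Catalan state $C$, $C(A)\neq 0$ if and only if $C$ is realizable.
   Context: **Catalan states.** For integers $m,n\ge 0$, consider a rectangle with points $x_1,\dots,x_n$ on its top side and $x'_1,\dots,x'_n$ on its bottom side (left to right), and $y_1,\dots,y_m$ on its left side and $y'_1,\dots,y'_m$ on its right side (top to bottom). A Catalan state is a family of pairwise disjoint arcs embedded in the rectangle joining these $2(m+n)$ points in pairs, up to isotopy fixing the boundary points (equivalently, a noncrossing perfect matching of the boundary points). $\mathrm{Cat}(m,n)$ is the set of all Catalan states for given $m,n$. **Coefficients and realizability.** A Kauffman state $s\in\mathcal{K}(m,n)$ of the $m\times n$-lattice crossing $L(m,n)$ is an assignment of $\pm1$ to the $mn$ crossings of the grid formed by $m$ horizontal segments (joining $y_i$ to $y'_i$) and $n$ vertical segments (joining $x_j$ to $x'_j$). $D_s$ is obtained by smoothing every crossing: a crossing marked $+1$ is replaced by two disjoint arcs joining its top end to its right end and its left end to its bottom end; one marked $-1$ by arcs joining top to left and right to bottom. $|D_s|$ is the number of closed components of $D_s$, and $C_s\in\mathrm{Cat}(m,n)$ is $D_s$ with its closed components removed. With $p(s),n(s)$ the numbers of $+1$'s and $-1$'s of $s$, for $C\in\mathrm{Cat}(m,n)$ put $$C(A)=\sum_{s\in\mathcal{K}(m,n),\ C_s=C}A^{p(s)-n(s)}(-A^2-A^{-2})^{|D_s|}.$$ A Catalan state $C\in\mathrm{Cat}(m,n)$ is realizable if $C=C_s$ for some $s\in\mathcal{K}(m,n)$. *)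

(* Defs.v *)
From mathcomp Require Import all_boot all_order all_algebra.

Set Implicit Arguments.
Unset Strict Implicit.
Unset Printing Implicit Defensive.

Import GRing.Theory.
Local Open Scope ring_scope.

(* Indices start at 0: x_(j+1), x'_(j+1), y_(i+1), y'_(i+1) in the usual
   numbering are xtop j, xbot j, yleft i, yright i. *)
Definition bpoint (m n : nat) : finType :=
  (('I_n + 'I_n) + ('I_m + 'I_m))%type.

Definition xtop {m n : nat} (j : 'I_n) : bpoint m n := inl (inl j).
Definition xbot {m n : nat} (j : 'I_n) : bpoint m n := inl (inr j).
Definition yleft {m n : nat} (i : 'I_m) : bpoint m n := inr (inl i).
Definition yright {m n : nat} (i : 'I_m) : bpoint m n := inr (inr i).

(* Rank of a point when the boundary is read clockwise from the top left
   corner: x_1 .. x_n, y'_1 .. y'_m, x'_n .. x'_1, y_m .. y_1. *)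
Definition bpos {m n : nat} (b : bpoint m n) : nat :=
  match b with
  | inl (inl j) => j
  | inr (inr i) => n + i
  | inl (inr j) => n + m + rev_ord j
  | inr (inl i) => n + m + n + rev_ord i
  end%N.

Definition noncrossing {m n : nat} (C : {set {set bpoint m n}}) : bool :=
  [forall a, forall b, forall c, forall d,
    ([set a; c] \in C) && ([set b; d] \in C) ==>
      ~~ [&& bpos a < bpos b, bpos b < bpos c & bpos c < bpos d]%N].

Definition perfect_matching {T : finType} (C : {set {set T}}) : bool :=
  partition C [set: T] && [forall P in C, #|P| == 2%N].

Definition Cat (m n : nat) : {set {set {set bpoint m n}}} :=
  [set C | perfect_matching C && noncrossing C].

(* true is the marker +1 and false the marker -1; (i, j) is the crossing of
   the horizontal segment from yleft i with the vertical one from xtop j. *)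
Definition kstate (m n : nat) : finType := {ffun 'I_m * 'I_n -> bool}.

(* The crossings cut the grid lines into edges: inl (i, k) is the k-th edge from
   the left on the i-th row, inr (k, j) the k-th edge from the top on the j-th
   column. *)
Definition edge (m n : nat) : finType :=
  (('I_m * 'I_n.+1) + ('I_m.+1 * 'I_n))%type.

Section Smoothing.

Variables m n : nat.
Implicit Types (c : 'I_m * 'I_n) (s : kstate m n).

Definition top_end c : edge m n := inr (widen_ord (leqnSn m) c.1, c.2).
Definition bottom_end c : edge m n := inr (lift ord0 c.1, c.2).
Definition left_end c : edge m n := inl (c.1, widen_ord (leqnSn n) c.2).
Definition right_end c : edge m n := inl (c.1, lift ord0 c.2).

Definition smoothing s c : {set {set edge m n}} :=
  if s c then [set [set top_end c; right_end c]; [set left_end c; bottom_end c]]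
  else [set [set top_end c; left_end c]; [set right_end c; bottom_end c]].

(* D_s is encoded by the graph on edges linking those joined by a smoothing
   arc; its connected components are the components of the curve D_s. *)
Definition joined s : rel (edge m n) :=
  fun e f => [exists c, [set e; f] \in smoothing s c].

Definition bedge (b : bpoint m n) : edge m n :=
  match b with
  | inl (inl j) => inr (ord0, j)
  | inl (inr j) => inr (ord_max, j)
  | inr (inl i) => inl (i, ord0)
  | inr (inr i) => inl (i, ord_max)
  end.

Definition on_closed s : pred (edge m n) :=
  fun e => [forall b, ~~ connect (joined s) (bedge b) e].

Definition nclosed s : nat := n_comp (joined s) (on_closed s).

(* When m = 0 or n = 0 two distinct boundary points can bound the same edge;
   they are then matched because connect is reflexive. *)
Definition cstate s : {set {set bpoint m n}} :=
  [set P | [exists a, exists b,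
     [&& a != b, connect (joined s) (bedge a) (bedge b) & P == [set a; b]]]].

Definition npos s : nat := #|[set c | s c]|.
Definition nneg s : nat := #|[set c | ~~ s c]|.

End Smoothing.

(* Laurent polynomials in A with integer coefficients are computed in the field
   of fractions of the polynomial ring Z[A], which contains Z[A, A^-1]. *)
Definition Avar : {fraction {poly int}} := tofrac 'X.

Definition coefA {m n : nat} (C : {set {set bpoint m n}}) :
    {fraction {poly int}} :=
  \sum_(s : kstate m n | cstate s == C)
    Avar ^ ((npos s)%:Z - (nneg s)%:Z)
      * (- Avar ^+ 2 - Avar ^- 2) ^+ nclosed s.

Definition realizable {m n : nat} (C : {set {set bpoint m n}}) : Prop :=
  exists s : kstate m n, C = cstate s.

(* Main.v *)
Require Import Defs.
From mathcomp Require Import all_boot all_order all_algebra.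
From mathcomp Require Import zify.

(** Read a marker +1 as the trivial braid and a marker -1 as a Temperley-Lieb
    cup-cap, the left and top sides being the input and the bottom and right
    sides the output; adding the crossings along antidiagonals then multiplies
    the state sum by factors [1 + A^-2 e].  With [d = n(s) - |D_s|], a state
    contributes [A^(mn-2d) (-1)^|D_s| (1 + A^-4)^|D_s|], so the coefficient of
    the top degree of [C(A)] is the sum of [(-1)^|D_s|] over the states of [C]
    with [d] minimal.  It is positive, by induction on the number of crossings
    added.  If [C] has no cup at the last crossing, nothing changes.  Otherwise
    closing a loop there exactly cancels the states with +1 at the last
    crossing, and what is left is a sum of coefficients known to be
    nonnegative; it is not empty because a state whose curve has a cup on the
    output side can be given a smaller [d] by changing one -1 into +1, which
    either keeps the curve or cuts the cup open. *)

Set Implicit Arguments.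
Unset Strict Implicit.
Unset Printing Implicit Defensive.

Import Order.TTheory GRing.Theory Num.Theory.

(** * Outcomes of a Temperley-Lieb word *)

Section Reconnect.

Variable V : finType.
Implicit Types (M : {ffun V -> V}) (x y z u : V).

Definition matching M := forall z, M (M z) = z /\ M z != z.

(* Turns the pairs {x, M x}, {y, M y} into {x, y}, {M x, M y}; it is the
   identity when M x = y. *)
Definition reconnect x y M : {ffun V -> V} :=
  [ffun z => if z == x then y else if z == y then x
             else if z == M x then M y else if z == M y then M x else M z].

Ltac decide_eqs :=
  repeat match goal with
  | H : is_true (?a != ?a) |- _ => by rewrite eqxx in H
  | H : is_true (?a != ?b) |- context [?a == ?b] => rewrite (negPf H)
  | H : is_true (?b != ?a) |- context [?a == ?b] => rewrite (eq_sym a b) (negPf H)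
  | |- context [?a == ?a] => rewrite eqxx
  | H : ?f ?a = _ |- context [?f ?a] => rewrite H
  | |- context [?a == ?b] => case: (eqVneq a b) => [?|?]; subst
  end; try done.

Lemma reconnect_id x M : matching M -> reconnect x (M x) M = M.
Proof.
move=> mM; apply/ffunP=> z; rewrite ffunE; case: (mM x) => -> _.
by do !case: eqVneq => [->|?] //; case: (mM x) => ->.
Qed.

Lemma matching_reconnect x y M :
  x != y -> matching M -> matching (reconnect x y M).
Proof.
move=> xy mM.
have Mi z : M (M z) = z by case: (mM z).
have Mn z : M z != z by case: (mM z).
have Minj := can_inj Mi.
have [Mxy|Mxy] := eqVneq (M x) y.
  by rewrite -Mxy reconnect_id.
have yMx : y != M x by rewrite eq_sym.
have Myx : M y != x by apply: contraNneq Mxy => <-; rewrite Mi.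
have MxMy : M x != M y by rewrite (inj_eq Minj).
have := Mn x; have := Mn y => ? ?.
move=> z; rewrite !ffunE.
have [->|zx] := eqVneq z x; first by decide_eqs.
have [->|zy] := eqVneq z y; first by decide_eqs.
have [->|zMx] := eqVneq z (M x); first by decide_eqs.
have [->|zMy] := eqVneq z (M y); first by decide_eqs.
have e1 : M z != x by apply: contraNneq zMx => <-; rewrite Mi.
have e2 : M z != y by apply: contraNneq zMy => <-; rewrite Mi.
have e3 : M z != M x by rewrite (inj_eq Minj).
have e4 : M z != M y by rewrite (inj_eq Minj).
by have := Mn z; have := Mi z; decide_eqs.
Qed.

Lemma reconnectC x y M : reconnect x y M = reconnect y x M.
Proof.
by apply/ffunP=> z; rewrite !ffunE; do !case: eqVneq => [?|?] //; congruence.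
Qed.

Lemma matching_inj M : matching M -> injective M.
Proof. by move=> mM; apply: (can_inj (g := M)) => z; case: (mM z). Qed.

(** Swapping [x] and [y] for their partners only interchanges the two new pairs. *)
Lemma reconnect_partners x y M : matching M -> x != y -> M x != y ->
  reconnect (M x) (M y) M = reconnect x y M.
Proof.
move=> mM xy Mxy; have Minj := matching_inj mM.
have Mi z : M (M z) = z by case: (mM z).
have Mn z : M z != z by case: (mM z).
have Myx : M y != x by apply: contraNneq Mxy => <-; rewrite Mi.
have MxMy : M x != M y by rewrite (inj_eq Minj); apply: contraNneq xy => ->.
have := Mn x; have := Mn y => ? ?.
apply/ffunP=> z; rewrite !ffunE !Mi.
have [?|?] := eqVneq z x; first by try subst z; decide_eqs.
have [?|?] := eqVneq z y; first by try subst z; decide_eqs.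
have [?|?] := eqVneq z (M x); first by try subst z; decide_eqs.
have [?|?] := eqVneq z (M y); by try subst z; decide_eqs.
Qed.

Lemma reconnect_partner x v M : matching M -> v != x -> v != M x ->
  reconnect (M x) v M = reconnect x (M v) M.
Proof.
move=> mM vx vMx; have Mi z : M (M z) = z by case: (mM z).
have Minj := matching_inj mM.
rewrite -{1}[v]Mi reconnect_partners //; last by rewrite (inj_eq Minj) eq_sym.
by apply: contraNneq vMx => ->; rewrite Mi.
Qed.

(** Joining [x] to its old partner breaks both new pairs, which leaves [y] with [M y]. *)
Lemma reconnectK x y M : matching M -> x != y ->
  reconnect x (M x) (reconnect x y M) = M.
Proof.
move=> mM xy; have Minj := matching_inj mM.
have Mi z : M (M z) = z by case: (mM z).
have Mn z : M z != z by case: (mM z).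
have [Mxy|Mxy] := eqVneq (M x) y.
  by rewrite -Mxy !reconnect_id.
have Myx : M y != x by apply: contraNneq Mxy => <-; rewrite Mi.
have MxMy : M x != M y by rewrite (inj_eq Minj).
have := Mn x; have := Mn y => ? ?.
apply/ffunP=> z; rewrite !ffunE.
have [->|zx] := eqVneq z x; first by decide_eqs.
have [->|zy] := eqVneq z y; first by decide_eqs.
have [->|zMx] := eqVneq z (M x); first by decide_eqs.
have [->|zMy] := eqVneq z (M y); by decide_eqs.
Qed.

(** The pairs of [x] and [u] are disjoint from those of [p] and [q]. *)
Lemma reconnect_comm x u p q M :
  matching M -> x != u -> M x != u -> p != q -> M p != q ->
  [/\ x != p, x != q, x != M p & x != M q] ->
  [/\ u != p, u != q, u != M p & u != M q] ->
  reconnect p q (reconnect x u M) = reconnect x u (reconnect p q M).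
Proof.
move=> mM xu Mxu pq Mpq [xp xq xMp xMq] [up uq uMp uMq].
have Minj := matching_inj mM.
have Mi z : M (M z) = z by case: (mM z).
have Mn z : M z != z by case: (mM z).
have neM a b : a != M b -> M a != b by apply: contraNneq => <-; rewrite Mi.
have ? := neM _ _ xMp. have ? := neM _ _ xMq.
have ? := neM _ _ uMp. have ? := neM _ _ uMq.
have ? : M q != p by rewrite neM // eq_sym.
have ? : M u != x by rewrite neM // eq_sym.
have inj a b : a != b -> M a != M b by rewrite (inj_eq Minj).
have ? := inj _ _ xu. have ? := inj _ _ pq.
have ? := inj _ _ xp. have ? := inj _ _ xq.
have ? := inj _ _ up. have ? := inj _ _ uq.
have := Mn x; have := Mn u; have := Mn p; have := Mn q => ? ? ? ?.
apply/ffunP=> z; rewrite !ffunE.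
have [?|?] := eqVneq z x; first by try subst z; decide_eqs.
have [?|?] := eqVneq z u; first by try subst z; decide_eqs.
have [?|?] := eqVneq z p; first by try subst z; decide_eqs.
have [?|?] := eqVneq z q; first by try subst z; decide_eqs.
have [?|?] := eqVneq z (M x); first by try subst z; decide_eqs.
have [?|?] := eqVneq z (M u); first by try subst z; decide_eqs.
have [?|?] := eqVneq z (M p); first by try subst z; decide_eqs.
have [?|?] := eqVneq z (M q); by try subst z; decide_eqs.
Qed.

(** Three pairs are involved; both sides leave {p, q}, {x, M q} and {M x, M p}. *)
Lemma reconnect_exchange x p q M :
  matching M -> p != q -> M p != q ->
  [/\ x != p, x != q, x != M p & x != M q] ->
  reconnect p q (reconnect x p M) = reconnect x (M q) (reconnect p q M).
Proof.
move=> mM pq Mpq [xp xq xMp xMq].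
have Minj := matching_inj mM.
have Mi z : M (M z) = z by case: (mM z).
have Mn z : M z != z by case: (mM z).
have neM a b : a != M b -> M a != b by apply: contraNneq => <-; rewrite Mi.
have ? := neM _ _ xMp. have ? := neM _ _ xMq.
have ? : M q != p by rewrite neM // eq_sym.
have inj a b : a != b -> M a != M b by rewrite (inj_eq Minj).
have ? := inj _ _ pq.
have ? := inj _ _ xp. have ? := inj _ _ xq.
have := Mn x; have := Mn p; have := Mn q => ? ? ?.
apply/ffunP=> z; rewrite !ffunE.
have [?|?] := eqVneq z x; first by try subst z; decide_eqs.
have [?|?] := eqVneq z p; first by try subst z; decide_eqs.
have [?|?] := eqVneq z q; first by try subst z; decide_eqs.
have [?|?] := eqVneq z (M x); first by try subst z; decide_eqs.
have [?|?] := eqVneq z (M p); first by try subst z; decide_eqs.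
have [?|?] := eqVneq z (M q); by try subst z; decide_eqs.
Qed.

End Reconnect.

(** * Temperley-Lieb words and their signed counts *)

Section Outcomes.

Variable V : finType.
Implicit Types (M : {ffun V -> V}) (p : V * V) (w : seq (V * V)).

(* A boundary matching, the number of markers -1 minus that of loops, and the
   number of loops. *)
Definition outcome : eqType := ({ffun V -> V} * nat * nat)%type.
Implicit Types (o : outcome).

(** On a matching that already has the cup, the cup-cap closes a loop: markers -1 and loops both
    increase, so their difference stays. *)
Definition step p o : outcome :=
  if o.1.1 p.1 == p.2 then (o.1.1, o.1.2, o.2.+1)
  else (reconnect p.1 p.2 o.1.1, o.1.2.+1, o.2).

Definition branch (T : Type) (f : T -> T) (r : seq T) := r ++ map f r.

Definition outcomes M0 w : seq outcome :=
  foldl (fun O p => branch (step p) O) [:: (M0, 0, 0)] w.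

Definition signed_count M d (O : seq outcome) : int :=
  (\sum_(o <- O | (o.1.1 == M) && (o.1.2 == d)) (-1) ^+ o.2)%R.

Variables (M0 : {ffun V -> V}) (out : pred V).
Hypotheses (matM0 : matching M0)
  (M0_out : forall x y, out x -> out y -> M0 x != y).

Definition letter p := [&& p.1 != p.2, out p.1 & out p.2].

Lemma outcomes_rcons w p :
  outcomes M0 (rcons w p) =
  outcomes M0 w ++ [seq step p o | o <- outcomes M0 w].
Proof. by rewrite /outcomes foldl_rcons. Qed.

Lemma matching_outcomes w o :
  all letter w -> o \in outcomes M0 w -> matching o.1.1.
Proof.
elim/last_ind: w o => [|w p IHw] o; first by rewrite inE => _ /eqP->.
rewrite all_rcons outcomes_rcons => /andP[/and3P[p12 _ _] lw].
rewrite mem_cat => /orP[/(IHw _ lw) //|/mapP[o' /(IHw _ lw) mo' ->]].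
rewrite /step; case: ifP => // _.
by apply: matching_reconnect.
Qed.

(* By reconnectK, reconnecting x and y in the last alternative recovers o.1.1. *)
Lemma shorten w o x y : all letter w -> o \in outcomes M0 w ->
  out x -> out y -> o.1.1 x = y ->
  exists o', [/\ o' \in outcomes M0 w, o'.1.2 < o.1.2 &
    o'.1.1 = o.1.1 \/
    exists u, [/\ u != x, u != y & o'.1.1 = reconnect x u o.1.1]].
Proof.
move=> + + outx outy; elim/last_ind: w o => [|w p IHw] o.
  rewrite inE => _ /eqP-> /= M0xy.
  by have := M0_out outx outy; rewrite M0xy eqxx.
rewrite all_rcons outcomes_rcons => /andP[/and3P[p12 outp1 outp2] lw].
have wide o' : o' \in outcomes M0 w ->
  o' \in outcomes M0 w ++ [seq step p o | o <- outcomes M0 w].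
  by rewrite mem_cat => ->.
rewrite mem_cat => /orP[/(IHw _ lw) IH oxy|].
  have [o' [o'w o'o Ho']] := IH oxy; exists o'; split=> //; exact: wide.
(* A last letter that closes a loop changes neither the matching nor the second component. *)
case/mapP=> o1 o1w ->; rewrite /step; case: ifPn => [cup /= oxy|cup].
  have [o' [o'w o'o Ho']] := IHw _ lw o1w oxy.
  by exists o'; split=> //; apply: wide.
set p1 := p.1 in p12 outp1 cup *; set p2 := p.2 in p12 outp2 cup *.
have := matching_outcomes lw o1w; set M := o1.1.1 => mM.
rewrite /= => oxy.
have Mi z : M (M z) = z by case: (mM z).
have Mn z : M z != z by case: (mM z).
have Minj := matching_inj mM.
have mN := matching_reconnect p12 mM.
have cup' : M p2 != p1 by apply: contraNneq cup => <-; rewrite Mi.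
(* If [x] lies on a pair made by the last letter, that letter is skipped: the second component drops
   by one and [x] regains its partner [M u]. By the symmetries of [reconnect], each of the four
   points can play [u]. *)
have ends u v : reconnect u v M = reconnect p1 p2 M -> u != v -> M u != v ->
    x = u -> exists o', [/\
    o' \in outcomes M0 w ++ [seq step p o | o <- outcomes M0 w],
    o'.1.2 < o1.1.2.+1 & o'.1.1 = reconnect p1 p2 M \/
    exists u, [/\ u != x, u != y & o'.1.1 = reconnect x u (reconnect p1 p2 M)]].
  move=> Euv uv Muv xu; exists o1; split; [exact: wide | exact: leqnn | right].
  have yv : y = v by rewrite -oxy -Euv xu ffunE eqxx.
  exists (M u); rewrite xu yv; split => //.
  by rewrite -Euv reconnectK.
have [xp1|xp1] := eqVneq x p1; first exact: (ends p1 p2).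
have [xp2|xp2] := eqVneq x p2.
  by apply: (ends p2 p1) => //; [rewrite reconnectC | rewrite eq_sym].
have Mp12 : M p1 != M p2 by rewrite (inj_eq Minj).
have [xMp1|xMp1] := eqVneq x (M p1).
  apply: (ends (M p1) (M p2)) => //; first by rewrite reconnect_partners.
  by rewrite Mi eq_sym.
have [xMp2|xMp2] := eqVneq x (M p2).
  apply: (ends (M p2) (M p1)) => //.
  - by rewrite reconnectC reconnect_partners.
  - by rewrite eq_sym.
  - by rewrite Mi eq_sym.
(* Otherwise the cup is older than the last letter, which is applied again after the induction
   hypothesis. *)
have {oxy} Mxy : M x = y.
  by move: oxy; rewrite ffunE !ifN.
have [o' [o'w o'o Ho']] := IHw _ lw o1w Mxy.
have yMp1 : y != p1 by rewrite -Mxy; apply: contraNneq xMp1 => <-; rewrite Mi.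
have yMp2 : y != p2 by rewrite -Mxy; apply: contraNneq xMp2 => <-; rewrite Mi.
have yp1 : y != M p1 by rewrite -Mxy (inj_eq Minj).
have yp2 : y != M p2 by rewrite -Mxy (inj_eq Minj).
exists (step p o'); split.
- by rewrite mem_cat map_f ?orbT.
- rewrite /step; case: ifP => _ /=; last by rewrite ltnS.
  exact: ltn_trans o'o _.
have Myx : M y = x by rewrite -Mxy Mi.
case: Ho' => [EM|[u [ux uy EM]]]; rewrite -/M in EM.
  by left; rewrite /step EM ifN.
right; have NE z : z != p1 -> z != p2 -> z != M p1 -> z != M p2 ->
    reconnect p1 p2 M z = M z.
  by move=> *; rewrite ffunE !ifN.
have Nx := NE x xp1 xp2 xMp1 xMp2; rewrite Mxy in Nx.
have Np : reconnect p1 p2 M (M p1) = M p2.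
  by rewrite ffunE (negPf (Mn p1)) (negPf cup) eqxx.
have Np' : reconnect p1 p2 M (M p2) = M p1.
  case: (mN (M p1)) => + _; by rewrite Np.
(* Opening the cup at [x], [y] does not create the pair [p1], [p2], so the letter acts on [o'] by
   reconnecting. *)
have no_cup : o'.1.1 p1 != p2.
  rewrite EM ffunE; case: ifP => [/eqP E|_]; first by rewrite E eqxx in xp1.
  case: ifP => [/eqP E|_] //.
  rewrite Mxy; case: ifP => [/eqP E|_]; first by rewrite E eqxx in yMp1.
  case: ifP => [_|_] //; by rewrite eq_sym -Mxy.
have xx : [/\ x != p1, x != p2, x != M p1 & x != M p2] by split.
have yy : [/\ y != p1, y != p2, y != M p1 & y != M p2] by split.
rewrite /step (negPf no_cup) /= EM -/p1 -/p2.
have swap := reconnect_partner mM; have swapN := reconnect_partner mN.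
(* The opening of the cup is moved past the last letter. If [u] lies on a pair of that letter, the
   cup is opened towards another point instead; for [u] a partner of [p1] or [p2], the ends [x] and
   [y] are exchanged first. *)
have [up1|up1] := eqVneq u p1.
  exists (M p2); split; [by rewrite eq_sym | by rewrite eq_sym |].
  by rewrite up1 reconnect_exchange.
have [up2|up2] := eqVneq u p2.
  exists (M p1); split; [by rewrite eq_sym | by rewrite eq_sym |].
  rewrite up2 reconnectC reconnect_exchange //; first by rewrite (reconnectC p2).
  by rewrite eq_sym.
have [uMp1|uMp1] := eqVneq u (M p1).
  exists (M p1); split; [by rewrite eq_sym | by rewrite eq_sym |].
  rewrite uMp1 -swap ?Mxy 1?eq_sym // reconnect_exchange // -Nx swapN ?Nx ?Np' //.
    by rewrite eq_sym.
  by rewrite eq_sym.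
have [uMp2|uMp2] := eqVneq u (M p2).
  exists (M p2); split; [by rewrite eq_sym | by rewrite eq_sym |].
  rewrite uMp2 -swap ?Mxy 1?eq_sym // reconnectC reconnect_exchange //.
    rewrite (reconnectC p2) -Nx swapN ?Nx ?Np //; by rewrite eq_sym.
  by rewrite eq_sym.
exists u; split=> //; apply: reconnect_comm; rewrite // ?Mxy eq_sym //.
Qed.

Local Open Scope ring_scope.

(** An outcome of [w] with matching [M] occurs twice, skipping the letter and closing a loop, with
    the same second component and opposite signs. What survives are the outcomes that the letter
    really reconnects. *)
Lemma signed_count_rcons M d w p : M p.1 == p.2 ->
  signed_count M d (outcomes M0 (rcons w p)) =
  \sum_(o <- outcomes M0 w | [&& o.1.1 p.1 != p.2,
      reconnect p.1 p.2 o.1.1 == M & o.1.2.+1 == d]) (-1) ^+ o.2.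
Proof.
move=> cupM; rewrite outcomes_rcons /signed_count big_cat big_map /=.
rewrite [X in _ + X](bigID (fun o => o.1.1 p.1 == p.2)) /= addrA.
rewrite [X in _ + X + _](_ : _ =
    - \sum_(o <- outcomes M0 w | (o.1.1 == M) && (o.1.2 == d)) (-1) ^+ o.2);
    last first.
  rewrite -sumrN; apply: eq_big => [o|o /andP[_ cup]].
    rewrite /step; case: ifP => /= [_ | ncup]; first by rewrite andbT.
    by rewrite andbF; case: eqP => //= EM; rewrite EM cupM in ncup.
  by rewrite /step cup /= exprS mulN1r.
rewrite subrr add0r; apply: eq_big => [o|o /andP[_ ncup]]; rewrite /step.
  by case: ifP => /= ncup; rewrite ?andbF ?andbT ?ncup.
by rewrite (negPf ncup).
Qed.

(** Grouping by the matching before the last letter expresses the surviving sum by signed counts of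
    the shorter word. *)
Lemma signed_count_by_matching d w p M :
  \sum_(o <- outcomes M0 w | [&& o.1.1 p.1 != p.2,
      reconnect p.1 p.2 o.1.1 == M & o.1.2.+1 == d.+1]) (-1) ^+ o.2 =
  \sum_(M' : {ffun V -> V} | (M' p.1 != p.2) && (reconnect p.1 p.2 M' == M))
    signed_count M' d (outcomes M0 w) :> int.
Proof.
rewrite (partition_big (fun o => o.1.1)
  (fun M' => (M' p.1 != p.2) && (reconnect p.1 p.2 M' == M))) /=; last first.
  by move=> o /and3P[-> ->].
apply: eq_bigr => M' /andP[ncup EM]; apply: eq_bigl => o.
have [->|] := eqVneq o.1.1 M'; last by rewrite andbF.
by rewrite ncup EM eqSS andbT.
Qed.

(** Minimality is essential to the induction: it makes every signed count left after the
    cancellation either positive or empty. *)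
Lemma signed_count_gt0 w o :
  all letter w -> o \in outcomes M0 w ->
  (forall o', o' \in outcomes M0 w -> o'.1.1 = o.1.1 -> (o.1.2 <= o'.1.2)%N) ->
  0 < signed_count o.1.1 o.1.2 (outcomes M0 w).
Proof.
elim/last_ind: w o => [|w p IHw] o.
  rewrite inE => _ /eqP-> _.
  by rewrite /signed_count big_cons big_nil /= !eqxx addr0 expr0.
move=> lwp ow omin; have := lwp.
rewrite all_rcons => /andP[/and3P[p12 outp1 outp2] lw].
have [cup|ncup] := boolP (o.1.1 p.1 == p.2); last first.
  rewrite outcomes_rcons /signed_count big_cat big_map /=.
  (* Applying the letter always leaves a cup at [p], so only outcomes that skip it have this
     matching. *)
  rewrite [X in _ + X]big1 ?addr0 => [|o' /andP[/eqP Eo' _]]; last first.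
    move: ncup; rewrite -Eo' /step; case: ifP => [->//|_].
    by rewrite ffunE eqxx eqxx.
  have {}ow : o \in outcomes M0 w.
    move: ow; rewrite outcomes_rcons mem_cat => /orP[//|/mapP[o' _ Eo]].
    move: ncup; rewrite Eo /step; case: ifP => [/= ->//|_].
    by rewrite ffunE eqxx eqxx.
  apply: IHw => // o' o'w; apply: omin.
  by rewrite outcomes_rcons mem_cat o'w.
(* The sum left after the cancellation is not empty. *)
have [o1 [o1w ncup1 Uo1 do1]] : exists o1, [/\ o1 \in outcomes M0 w,
    o1.1.1 p.1 != p.2, reconnect p.1 p.2 o1.1.1 = o.1.1 & o1.1.2.+1 = o.1.2].
  (* If the minimum is already attained by [w], [shorten] applies to the cup at [p]. Keeping the
     matching would contradict minimality, so the cup is opened; applying the letter restores it,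
     and minimality forces the second component to be exactly one less before the letter. *)
  have of_prefix o2 : o2 \in outcomes M0 w -> o2.1.1 = o.1.1 ->
      o2.1.2 = o.1.2 -> exists o1, [/\ o1 \in outcomes M0 w,
      o1.1.1 p.1 != p.2, reconnect p.1 p.2 o1.1.1 = o.1.1 & o1.1.2.+1 = o.1.2].
    move=> o2w M2 d2; have cup2 := cup; rewrite -M2 in cup2.
    have [o1 [o1w lt1 Ho1]] := shorten lw o2w outp1 outp2 (eqP cup2).
    have o1wp : o1 \in outcomes M0 (rcons w p).
      by rewrite outcomes_rcons mem_cat o1w.
    case: Ho1 => [EM|[u [up1 up2 EM]]].
      have := omin o1 o1wp (etrans EM M2).
      by rewrite -d2 leqNgt lt1.
    have mM2 := matching_outcomes lw o2w.
    have U1 : reconnect p.1 p.2 o1.1.1 = o.1.1.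
      by rewrite EM -(eqP cup2) reconnectK // eq_sym.
    have n1 : o1.1.1 p.1 != p.2 by rewrite EM ffunE eqxx.
    exists o1; split=> //; apply/eqP; rewrite eqn_leq -{1}d2 lt1 /=.
    have := omin (step p o1); rewrite /step (negPf n1) /=; apply; last by [].
    rewrite outcomes_rcons mem_cat; apply/orP; right; apply/mapP.
    by exists o1; rewrite // /step (negPf n1).
  move: (ow); rewrite outcomes_rcons mem_cat => /orP[ow'|/mapP[o2 o2w Eo]].
    exact: (of_prefix o).
  have [cup2|ncup2] := boolP (o2.1.1 p.1 == p.2).
    by apply: (of_prefix o2) => //; rewrite Eo /step cup2.
  by exists o2; split=> //; rewrite Eo /step (negPf ncup2).
rewrite signed_count_rcons // -do1 signed_count_by_matching.
have min1 o' : o' \in outcomes M0 w -> o'.1.1 p.1 != p.2 ->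
    reconnect p.1 p.2 o'.1.1 = o.1.1 -> (o1.1.2 <= o'.1.2)%N.
  move=> o'w n' U'; rewrite -ltnS do1.
  have := omin (step p o'); rewrite /step (negPf n') /=; apply; last by [].
  rewrite outcomes_rcons mem_cat; apply/orP; right; apply/mapP.
  by exists o'; rewrite // /step (negPf n').
rewrite (bigD1 o1.1.1) /=; last by rewrite ncup1 Uo1 eqxx.
apply: ltr_wpDr; last first.
  apply: IHw => // o' o'w E'; apply: min1 => //; by rewrite E'.
apply: sumr_ge0 => M' /andP[/andP[n' /eqP U'] _].
(* If [M'] attains the value [o1.1.2], this is its minimum by [min1] and the induction hypothesis
   applies; if not, the sum is empty. *)
have [/hasP[o' o'w /andP[/eqP E' /eqP d']]|no] :=
  boolP (has (fun o' => (o'.1.1 == M') && (o'.1.2 == o1.1.2)) (outcomes M0 w)).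
  rewrite -E' -d'; apply/ltW/IHw => // o2 o2w E2; rewrite d'.
  by apply: min1 => //; rewrite E2 E'.
by rewrite /signed_count big_hasC.
Qed.

End Outcomes.

(** * Smoothings as graphs *)

Lemma set2_eqE (T : finType) (a b c d : T) :
  ([set a; b] == [set c; d]) =
  (a == c) && (b == d) || (a == d) && (b == c).
Proof.
apply/eqP/idP => [E|/orP[/andP[/eqP-> /eqP->]|/andP[/eqP-> /eqP->]]] //; last first.
  by rewrite setUC.
have := set21 a b; have := set22 a b; rewrite E !inE.
have := set21 c d; have := set22 c d; rewrite -E !inE.
by do 4!(move/orP=> []/eqP ?); subst; rewrite !eqxx ?orbT.
Qed.

Lemma connect_ind (T : finType) (e : rel T) (P : T -> Prop) x y :
  (forall u v, e u v -> P u -> P v) -> connect e x y -> P x -> P y.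
Proof.
move=> eP /connectP[s + ->]; elim: s x => //= z s IHs x /andP[xz pth] Px.
exact/IHs/(eP x).
Qed.

(** Components counted as sets, not as chosen roots, can be compared between the graphs of two
    states. *)
Lemma n_comp_card (T : finType) (e : rel T) (a : pred T) :
  connect_sym e -> closed e a ->
  n_comp e a = #|[set [set y | connect e x y] | x in a]|.
Proof.
move=> sym_e cl_a.
have injR : {in [pred x | roots e x & a x] &,
    injective (fun x => [set y | connect e x y])}.
  move=> x y /andP[rx _] /andP[ry _] /setP/(_ y).
  rewrite !inE connect0 => /(introT idP); rewrite -root_connect //.
  by move/eqP; rewrite (eqP rx) (eqP ry).
transitivity #|[set [set y | connect e x y] | x in [pred x | roots e x & a x]]|.
  rewrite card_in_imset //.
congr #|pred_of_set _|; apply/setP=> S; apply/imsetP/imsetP => -[x].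
  by case/andP=> _ ax ->; exists x.
move=> ax ->; exists (fingraph.root e x).
  by rewrite inE roots_root //= -[a _](closed_connect cl_a (connect_root e x)).
by apply/setP=> y; rewrite !inE; apply: same_connect; rewrite // connect_root.
Qed.

(** * Strands of the lattice crossing *)

Section Lattice.
Variables m n : nat.
Implicit Types (s : kstate m n) (c d : 'I_m * 'I_n) (e f : edge m n).
Implicit Types (x y : bpoint m n).

Definition top_mate s c := if s c then right_end c else left_end c.
Definition bottom_mate s c := if s c then left_end c else right_end c.

Lemma joined_sym s : symmetric (joined s).
Proof.
by move=> e f; apply: eq_existsb => c; rewrite [[set e; f]]setUC.
Qed.

Lemma connect_joined_sym s : connect_sym (joined s).
Proof. exact/sym_connect_sym/joined_sym. Qed.

Lemma joined_top s c : joined s (top_end c) (top_mate s c).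
Proof.
apply/existsP; exists c; rewrite /smoothing /top_mate.
by case: (s c); rewrite !inE !set2_eqE !eqxx.
Qed.

Lemma joined_bottom s c : joined s (bottom_mate s c) (bottom_end c).
Proof.
apply/existsP; exists c; rewrite /smoothing /bottom_mate.
by case: (s c); rewrite !inE !set2_eqE !eqxx ?orbT.
Qed.

Lemma joined_ind s (P : edge m n -> edge m n -> Prop) :
  (forall e f, P e f -> P f e) ->
  (forall c, P (top_end c) (top_mate s c)) ->
  (forall c, P (bottom_mate s c) (bottom_end c)) ->
  forall e f, joined s e f -> P e f.
Proof.
move=> symP Ptop Pbot e f /existsP[c]; move: (Ptop c) (Pbot c).
rewrite /smoothing /top_mate /bottom_mate.
by case: (s c) => ? ?; rewrite !inE !set2_eqE -!orbA;
  case/or4P=> /andP[/eqP-> /eqP->]; auto.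
Qed.

(* With all markers +1, the strands are the fibres of diag. *)
Definition diag e : nat :=
  match e with inl (i, j) => j + m - i | inr (i, j) => j.+1 + m - i end.

(* The edges met after c by the two strands leaving c at its right and bottom
   ends, when all the crossings below the antidiagonal of c are marked +1. *)
Definition beyond c e : bool :=
  match e with
  | inl (i, j) => (c.2 < j) && ((j + c.1 == c.2.+1 + i) || (j + c.1 == c.2 + i))
  | inr (i, j) => (c.1 < i) && ((j + c.1 == c.2 + i) || (j.+1 + c.1 == c.2 + i))
  end.

Definition before c d := (d != c) && (d.1 + d.2 <= c.1 + c.2).
(* In s, the crossing c and the ones not yet swept are marked +1. *)
Definition fresh s c := forall d, ~~ s d -> before c d.

Lemma crossing_neqP c d : d != c -> ~ (d.1 = c.1 :> nat /\ d.2 = c.2 :> nat).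
Proof.
case: c d => [i j] [i' j'] /eqP dc [/= /ord_inj Ei /ord_inj Ej].
by apply: dc; rewrite Ei Ej.
Qed.

Lemma diag_joined s : (forall d, s d) ->
  forall e f, joined s e f -> diag e = diag f.
Proof.
move=> sT; apply: joined_ind => [e f //|d|d]; rewrite /top_mate /bottom_mate sT.
all: by rewrite /= /bump /=; have := ltn_ord d.1; lia.
Qed.

(** At a crossing marked +1 the region follows the strand. A crossing marked -1 comes before [c],
    and none of its ends is beyond [c]. *)
Lemma beyond_top s c d : fresh s c -> d != c ->
  beyond c (top_end d) = beyond c (top_mate s d).
Proof.
move=> fr dc; have := crossing_neqP dc; rewrite /top_mate.
case: (boolP (s d)) => [_|/fr/andP[_]] /=; rewrite /bump /=; lia.
Qed.

Lemma beyond_bottom s c d : fresh s c -> d != c ->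
  beyond c (bottom_mate s d) = beyond c (bottom_end d).
Proof.
move=> fr dc; have := crossing_neqP dc; rewrite /bottom_mate.
case: (boolP (s d)) => [_|/fr/andP[_]] /=; rewrite /bump /=; lia.
Qed.

(** This follows a strand of the all-plus state back to the top or left side; each crossing passed
    lowers the sum of the indices by one. *)
Lemma edge_ind (P : edge m n -> Prop) :
  (forall j, P (bedge (xtop j))) -> (forall i, P (bedge (yleft i))) ->
  (forall d, P (top_end d) -> P (right_end d)) ->
  (forall d, P (left_end d) -> P (bottom_end d)) ->
  forall e, P e.
Proof.
move=> Ptop Pleft Pright Pbottom e.
have [k] := ubnP (match e with inl (i, j) => i + j | inr (i, j) => i + j end).
elim: k e => // k IHk [[i j]|[i j]] le_k.
  have [j0|j_gt0] := posnP j.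
    by rewrite (_ : j = ord0); [exact: Pleft | exact: val_inj].
  have j'P : j.-1 < n by have := ltn_ord j; lia.
  rewrite (_ : inl (i, j) = right_end (i, Ordinal j'P)).
    by apply/Pright/IHk => /=; lia.
  by congr (inl (_, _)); apply: val_inj; rewrite /= /bump /=; lia.
have [i0|i_gt0] := posnP i.
  by rewrite (_ : i = ord0); [exact: Ptop | exact: val_inj].
have i'P : i.-1 < m by have := ltn_ord i; lia.
rewrite (_ : inr (i, j) = bottom_end (Ordinal i'P, j)).
  by apply/Pbottom/IHk => /=; lia.
by congr (inr (_, _)); apply: val_inj; rewrite /= /bump /=; lia.
Qed.

Lemma connect_right s d : s d -> connect (joined s) (top_end d) (right_end d).
Proof.
move=> sd; apply: connect1.
by have := joined_top s d; rewrite /top_mate sd.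
Qed.

Lemma connect_bottom s d : s d -> connect (joined s) (left_end d) (bottom_end d).
Proof.
move=> sd; apply: connect1.
by have := joined_bottom s d; rewrite /bottom_mate sd.
Qed.

(** The marker of [c] itself is left free, so that the lemma serves the state both before and after
    [c] is negated. *)
Lemma beyond_connect s c e :
  (forall d, c.1 + c.2 < d.1 + d.2 -> s d) -> beyond c e ->
  connect (joined s)
    (if diag e == diag (right_end c) then right_end c else bottom_end c) e.
Proof.
move=> s_gt; elim/edge_ind: e => [j|i|d IHd|d IHd] be.
- by move: be => /=; lia.
- by move: be => /=; lia.
- have [->|dc] := eqVneq d c; first by rewrite eqxx connect0.
  have Ed : diag (right_end d) = diag (top_end d) by rewrite /= /bump /=; lia.
  rewrite Ed; apply: connect_trans (connect_right _).
    by apply: IHd; move: be (crossing_neqP dc); rewrite /= /bump /=; lia.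
  by apply: s_gt; move: be (crossing_neqP dc); rewrite /= /bump /=; lia.
- have [->|dc] := eqVneq d c.
    by rewrite ifN ?connect0 //= /bump /=; have := ltn_ord c.1; lia.
  have Ed : diag (bottom_end d) = diag (left_end d) by rewrite /= /bump /=; lia.
  rewrite Ed; apply: connect_trans (connect_bottom _).
    by apply: IHd; move: be (crossing_neqP dc); rewrite /= /bump /=; lia.
  by apply: s_gt; move: be (crossing_neqP dc); rewrite /= /bump /=; lia.
Qed.

Lemma fresh_gt s c d : fresh s c -> c.1 + c.2 < d.1 + d.2 -> s d.
Proof.
move=> fr lt_cd; apply: contraLR lt_cd => /fr/andP[_].
by rewrite -leqNgt.
Qed.

(** * Components after one marker is changed to -1 *)

Definition negate c s : kstate m n := [ffun d => (d != c) && s d].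

Lemma negate_neq c s d : d != c -> negate c s d = s d.
Proof. by rewrite ffunE => ->. Qed.

Section Negate.

Variables (s : kstate m n) (c : 'I_m * 'I_n).
Hypothesis fr : fresh s c.
Let s' := negate c s.
Let W := beyond c.

Lemma fresh_at : s c.
Proof. by apply/negPn/negP=> /fr; rewrite /before eqxx. Qed.

Let Z e := connect (joined s) e (right_end c) ||
           connect (joined s) e (bottom_end c).

Let negate_gt d : c.1 + c.2 < d.1 + d.2 -> s' d.
Proof.
move=> lt_cd; rewrite negate_neq ?(fresh_gt fr) //.
by apply: contraTneq lt_cd => ->; rewrite ltnn.
Qed.

Let csym := connect_joined_sym.

Let s'c : s' c = false. Proof. by rewrite ffunE eqxx. Qed.

Let tl' : connect (joined s') (top_end c) (left_end c).
Proof. by apply: connect1; have := joined_top s' c; rewrite /top_mate s'c. Qed.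

Let rb' : connect (joined s') (right_end c) (bottom_end c).
Proof. by apply: connect1; have := joined_bottom s' c; rewrite /bottom_mate s'c. Qed.

Lemma beyond_Z e : W e -> Z e.
Proof.
move=> We; have := beyond_connect (fun d => @fresh_gt s c d fr) We; rewrite csym /Z.
by case: ifP => _ ->; rewrite ?orbT.
Qed.

Lemma beyond_negate e : W e -> connect (joined s') e (right_end c).
Proof.
move=> We; have := beyond_connect negate_gt We; rewrite csym.
by case: ifP => // _ ?;
  apply: connect_trans (_ : connect _ (bottom_end c) _); rewrite // csym.
Qed.

Let Wr : W (right_end c). Proof. rewrite /W /= /bump /=; lia. Qed.
Let Wb : W (bottom_end c). Proof. rewrite /W /= /bump /=; lia. Qed.
Let Wt : W (top_end c) = false. Proof. rewrite /W /=; lia. Qed.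
Let Wl : W (left_end c) = false. Proof. rewrite /W /=; lia. Qed.

Let joined_negate d : d != c ->
  joined s' (top_end d) (top_mate s d) /\
  joined s' (bottom_mate s d) (bottom_end d).
Proof.
move=> dc; split.
  by have := joined_top s' d; rewrite /top_mate negate_neq.
by have := joined_bottom s' d; rewrite /bottom_mate negate_neq.
Qed.

(** Collapsing the region beyond [c] onto [top_end c] carries a path of [s] to one of [s']: in [s]
    the region is entered only at [c], whose two other ends are joined in [s']. *)
Lemma connect_negate_outside u v : ~~ W u -> connect (joined s) u v ->
  connect (joined s') u (if W v then top_end c else v).
Proof.
move=> Wu uv; pose P v := connect (joined s') u (if W v then top_end c else v).
suff stepP v1 v2 : joined s v1 v2 -> P v1 <-> P v2.
  apply: (connect_ind (P := P)) uv _ => [v1 v2 /stepP[]//|].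
  by rewrite /P (negPf Wu) connect0.
apply: (joined_ind (P := fun v1 v2 => P v1 <-> P v2)) => [w1 w2|d|d].
- by case; split.
- have [->|dc] := eqVneq d c.
    by rewrite /top_mate fresh_at /P Wr Wt.
  have EW : W (top_mate s d) = W (top_end d) by exact/esym/beyond_top.
  rewrite /P EW; case: ifP => // _.
  have [/connect1 j _] := joined_negate dc.
  by rewrite (same_connect_r (@csym _) j).
- have [->|dc] := eqVneq d c.
    by rewrite /bottom_mate fresh_at /P Wb Wl (same_connect_r (@csym _) tl').
  have EW : W (bottom_mate s d) = W (bottom_end d) by exact: beyond_bottom.
  rewrite /P EW; case: ifP => // _.
  have [_ /connect1 j] := joined_negate dc.
  by rewrite (same_connect_r (@csym _) j).
Qed.

(* Negating c cuts off the two strands beyond c and joins them to each other,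
   and the two remaining ends of c to each other. *)
Lemma connect_negate u v :
  connect (joined s') u v =
  (W u == W v) && [|| W u, connect (joined s) u v | Z u && Z v].
Proof.
have tr : connect (joined s) (top_end c) (right_end c).
  exact/connect_right/fresh_at.
have lb : connect (joined s) (left_end c) (bottom_end c).
  exact/connect_bottom/fresh_at.
apply/idP/idP.
  (* The right-hand side is invariant along every link of [s']; only the links at [c] are new. *)
  pose P v := (W u == W v) && [|| W u, connect (joined s) u v | Z u && Z v].
  move=> uv; suff stepP v1 v2 : joined s' v1 v2 -> P v1 <-> P v2.
    apply: (connect_ind (P := P)) uv _ => [v1 v2 /stepP[]//|].
    by rewrite /P eqxx connect0 orbT.
  have old w1 w2 : joined s w1 w2 -> W w1 = W w2 -> P w1 <-> P w2.
    move=> /connect1 j EW.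
    by rewrite /P /Z EW (same_connect_r (@csym _) j) !(same_connect (@csym _) j).
  apply: (joined_ind (P := fun v1 v2 => P v1 <-> P v2)) => [w1 w2|d|d].
  - by case; split.
  - have [->|dc] := eqVneq d c; last first.
      rewrite /top_mate negate_neq //; apply: old; first exact: joined_top.
      exact: beyond_top.
    rewrite /top_mate s'c /P Wt Wl; have [//|Wu] := boolP (W u).
    rewrite (same_connect_r (@csym _) lb) (same_connect_r (@csym _) tr).
    rewrite /Z tr lb orbT; case: (connect _ u (right_end c)) => /=;
      by case: (connect _ u (bottom_end c)).
  - have [->|dc] := eqVneq d c; last first.
      rewrite /bottom_mate negate_neq //; apply: old; first exact: joined_bottom.
      exact: beyond_bottom.
    by rewrite /bottom_mate s'c /P Wr Wb; case: (W u).
case/andP; have [Wu|Wu] := boolP (W u).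
  move/eqP/esym/beyond_negate => Wv _.
  by apply: connect_trans (beyond_negate Wu) _; rewrite csym.
rewrite eq_sym eqbF_neg => Wv /=.
(* What remains of either cut strand now runs through the top end of [c]. *)
have toTop e : ~~ W e -> Z e -> connect (joined s') e (top_end c).
  by move=> We /orP[] /(connect_negate_outside We); rewrite ?Wr ?Wb.
case/orP=> [/(connect_negate_outside Wu)|/andP[Zu Zv]]; first by rewrite (negPf Wv).
by apply: connect_trans (toTop _ Wu Zu) _; rewrite csym toTop.
Qed.

End Negate.

(** * Boundary points and loops after the change *)

Definition outgoing x : bool :=
  match x with inl (inr _) | inr (inr _) => true | _ => false end.

(* Where the strands leaving c to the right and to the bottom end. *)
Definition rport c : bpoint m n :=
  if c.2 + m - c.1 < n then xbot (insubd c.2 (c.2 + m - c.1))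
  else yright (insubd c.1 (n + c.1 - c.2.+1)).

Definition bport c : bpoint m n :=
  if c.2 + m - c.1 <= n then xbot (insubd c.2 (c.2 + m - c.1).-1)
  else yright (insubd c.1 (n + c.1 - c.2)).

Lemma outgoing_rport c : outgoing (rport c).
Proof. by rewrite /rport; case: ifP. Qed.

Lemma outgoing_bport c : outgoing (bport c).
Proof. by rewrite /bport; case: ifP. Qed.

(** On the input sides, and again on the output sides, [diag] takes each value from 1 to m + n
    once. *)
Lemma diag_inj x y : outgoing x = outgoing y ->
  diag (bedge x) = diag (bedge y) -> x = y.
Proof.
case: x y => [[i|i]|[i|i]] [[j|j]|[j|j]] //= _; have := ltn_ord i;
  have := ltn_ord j; rewrite /diag /= => ltj lti E;
  solve [exfalso; lia | do 2!congr (_ _); apply: val_inj => /=; lia].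
Qed.

(** The index in [rport] solves this equation and is in range, so the default of [insubd] is never
    returned. *)
Lemma diag_rport c : diag (bedge (rport c)) = diag (right_end c).
Proof.
have := ltn_ord c.1; have := ltn_ord c.2.
rewrite /rport; case: ifP => lt /= ? ?; rewrite val_insubd ifT /bump; lia.
Qed.

Lemma diag_bport c : diag (bedge (bport c)) = diag (bottom_end c).
Proof.
have := ltn_ord c.1; have := ltn_ord c.2.
rewrite /bport; case: ifP => lt /= ? ?; rewrite val_insubd ifT /bump; lia.
Qed.

Lemma rport_neq_bport c : rport c != bport c.
Proof.
apply/eqP=> /(congr1 (fun x => diag (bedge x))); rewrite diag_rport diag_bport.
by have := ltn_ord c.1; rewrite /= /bump /=; lia.
Qed.

Lemma beyond_bedge c x : beyond c (bedge x) = (x == rport c) || (x == bport c).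
Proof.
have := ltn_ord c.1; have := ltn_ord c.2 => lt2 lt1.
have -> : beyond c (bedge x) = outgoing x &&
    ((diag (bedge x) == diag (right_end c)) ||
     (diag (bedge x) == diag (bottom_end c))).
  case: x => [[i|i]|[i|i]] /=; have := ltn_ord i; rewrite /bump /=; lia.
rewrite -diag_rport -diag_bport.
apply/idP/idP.
  case/andP=> ox /orP[]/eqP E; apply/orP; [left|right]; apply/eqP/diag_inj => //.
    by rewrite ox outgoing_rport.
  by rewrite ox outgoing_bport.
by case/orP=> /eqP->; rewrite eqxx ?orbT andbT ?outgoing_rport ?outgoing_bport.
Qed.

(** The curve of [s] as an involution of the boundary points, the form on which [reconnect] acts. *)
Definition linked s (M : {ffun bpoint m n -> bpoint m n}) :=
  matching M /\ forall x y,
    connect (joined s) (bedge x) (bedge y) = (y == x) || (y == M x).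

Lemma on_closedP s e :
  reflect (exists x, connect (joined s) (bedge x) e) (~~ on_closed s e).
Proof.
rewrite negb_forall; apply: (iffP existsP) => -[x]; first by rewrite negbK; exists x.
by exists x; rewrite negbK.
Qed.

Section NegatePorts.

Variables (s : kstate m n) (c : 'I_m * 'I_n).
Hypothesis fr : fresh s c.

Let csym := connect_joined_sym.

Lemma connect_rport : connect (joined s) (bedge (rport c)) (right_end c).
Proof.
rewrite csym; have := @beyond_connect s c (bedge (rport c)) (fun d => @fresh_gt s c d fr).
by rewrite diag_rport eqxx; apply; rewrite beyond_bedge eqxx.
Qed.

Lemma connect_bport : connect (joined s) (bedge (bport c)) (bottom_end c).
Proof.
rewrite csym; have := @beyond_connect s c (bedge (bport c)) (fun d => @fresh_gt s c d fr).
rewrite diag_bport ifN; first by apply; rewrite beyond_bedge eqxx orbT.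
by rewrite -diag_bport -diag_rport; apply: contra (rport_neq_bport c) => /eqP E;
  apply/eqP/diag_inj; rewrite // outgoing_bport outgoing_rport.
Qed.

Variable M : {ffun bpoint m n -> bpoint m n}.
Hypothesis sM : linked s M.
Let r := rport c.
Let b := bport c.

Lemma connect_negate_ports e f :
  connect (joined (negate c s)) e f = (beyond c e == beyond c f) &&
    [|| beyond c e, connect (joined s) e f |
      (connect (joined s) (bedge r) e || connect (joined s) (bedge b) e) &&
      (connect (joined s) (bedge r) f || connect (joined s) (bedge b) f)].
Proof.
rewrite connect_negate //.
have E g : connect (joined s) (bedge r) g || connect (joined s) (bedge b) g =
    connect (joined s) g (right_end c) || connect (joined s) g (bottom_end c).
  rewrite -(same_connect_r (@csym _) connect_rport).
  by rewrite -(same_connect_r (@csym _) connect_bport) ![connect _ g _]csym.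
by rewrite !E.
Qed.

(** The pieces beyond [c] become a cup between the ports, and the remainders of the two strands,
    with far ends [M r] and [M b], are joined through the top and left ends of [c]. If [M r = b],
    the remainder closes up and the matching is unchanged. *)
Lemma linked_negate : linked (negate c s) (reconnect r b M).
Proof.
case: sM => mM cM; split; first exact: matching_reconnect (rport_neq_bport c) mM.
have Mi z : M (M z) = z by case: (mM z).
have Mn z : M z != z by case: (mM z).
have rb := rport_neq_bport c; rewrite -/r -/b in rb.
move=> x y; rewrite connect_negate_ports !cM !beyond_bedge -/r -/b ffunE.
have Mx : (M x == r) = (x == M r) by apply/eqP/eqP => [<-|->]; rewrite ?Mi.
have Minj := matching_inj mM.
have [->|xr] := eqVneq x r; first by rewrite /= andbT eq_sym eqb_id [y == r]eq_sym.
have [->|xb] := eqVneq x b.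
  by rewrite /= andbT eq_sym eqb_id orbC.
have MxE z : (M x == z) = (x == M z).
  by apply/eqP/eqP => [<-|->]; rewrite Mi.
rewrite /=; have [->|yr] := eqVneq y r.
  rewrite /= eq_sym (negPf xr) /=; case: ifP => [/eqP Ex|xMr].
    rewrite eq_sym; apply/esym/negbTE.
    by apply: contra xb => /eqP Eb; rewrite Ex -Eb Mi.
  case: ifP => [_|_]; first by rewrite eq_sym (negPf (Mn r)).
  by rewrite eq_sym MxE xMr.
have [->|yb] := eqVneq y b.
  rewrite /= eq_sym (negPf xb) /=; case: ifP => [_|xMr].
    by rewrite eq_sym (negPf (Mn b)).
  case: ifP => [/eqP Ex|xMb].
    rewrite eq_sym; apply/esym/negbTE.
    by apply: contra xr => /eqP Er; rewrite Ex -Er Mi.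
  by rewrite eq_sym MxE xMb.
rewrite /=; case: (eqVneq x (M r)) => [->|xMr] /=.
  by rewrite Mi (negPf yr) /=; case: eqP.
case: (eqVneq x (M b)) => [->|xMb] /=.
  by rewrite Mi (negPf yb) /=; case: (y == M r); case: (y == M b).
by rewrite orbF.
Qed.

Let port e := connect (joined s) (bedge r) e || connect (joined s) (bedge b) e.

Lemma beyond_port e : beyond c e -> port e.
Proof.
move=> We; have := beyond_Z fr We.
rewrite -(same_connect_r (@csym _) connect_rport).
by rewrite -(same_connect_r (@csym _) connect_bport) ![connect _ e _]csym.
Qed.

(** Only the arc from [r] to [b], deprived of its pieces beyond [c], can become closed. *)
Lemma on_closed_negate e : on_closed (negate c s) e =
  on_closed s e || [&& M r == b, ~~ beyond c e & connect (joined s) (bedge r) e].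
Proof.
case: sM => mM cM; apply: negb_inj; rewrite negb_or.
have Mi z : M (M z) = z by case: (mM z).
have Mn z : M z != z by case: (mM z).
have portE x : port (bedge x) = [|| x == r, x == M r, x == b | x == M b].
  by rewrite /port !cM -orbA.
have cup_port f : M r = b -> port f -> connect (joined s) (bedge r) f.
  move=> Mrb /orP[//|]; apply: connect_trans; by rewrite cM Mrb eqxx orbT.
apply/on_closedP/andP => [[x]|[/on_closedP[x xe] no_loop]].
  rewrite connect_negate_ports; have [We|We] := boolP (beyond c e).
    rewrite andbF => _; split=> //; apply/on_closedP.
    by have /orP[?|?] := beyond_port We; [exists r | exists b].
  rewrite eqbF_neg => /andP[Wx]; rewrite (negPf Wx) /= -/(port _) -/(port e) => xe.
  have [xr xb] : x != r /\ x != b.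
    by move: Wx; rewrite beyond_bedge negb_or => /andP.
  have not_port : M r = b -> ~~ port (bedge x).
    move=> Mrb; rewrite portE Mrb -Mrb Mi Mrb !negb_or xr xb //.
  split.
    apply/on_closedP; case/orP: xe => [xe|/andP[_ /orP[?|?]]]; first by exists x.
      by exists r.
    by exists b.
  apply/andP=> -[/eqP Mrb re]; move/negP: (not_port Mrb); apply.
  case/orP: xe => [xe|/andP[]//].
  by rewrite /port (connect_trans re) // csym.
have [We|We] := boolP (beyond c e).
  by exists r; rewrite connect_negate_ports We beyond_bedge eqxx.
have [pe|npe] := boolP (port e).
  have Mrb : M r != b.
    apply: contra no_loop => Mrb; rewrite Mrb We /=.
    by apply: cup_port pe; apply/eqP.
  (* The far end [M r] is not cut off, and it reaches all that remains of the two strands. *)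
  exists (M r); rewrite connect_negate_ports beyond_bedge (negPf We) -/r -/b.
  rewrite (negPf (Mn r)) (negPf Mrb) /=; apply/orP; right; apply/andP; split=> //.
  by rewrite cM eqxx orbT.
exists x; rewrite connect_negate_ports (negPf We) xe orbT andbT eqbF_neg.
rewrite beyond_bedge; apply: contra npe; rewrite /port /r /b.
by case/orP=> /eqP <-; rewrite xe ?orbT.
Qed.

Lemma nclosed_negate : nclosed (negate c s) = nclosed s + (M r == b).
Proof.
have cl (t : kstate m n) :
    nclosed t = #|[set [set f | connect (joined t) e f] | e in on_closed t]|.
  apply: n_comp_card; first exact: connect_joined_sym.
  move=> e f /connect1 ef; apply: eq_forallb => x.
  by rewrite (same_connect_r (@csym _) ef).
have not_port e : on_closed s e -> ~~ port e.
  by apply: contraTN => /orP[] ?; apply/on_closedP; [exists r | exists b].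
have same e f : on_closed s e ->
    connect (joined (negate c s)) e f = connect (joined s) e f.
  move=> cle; have npe := not_port e cle.
  have We : ~~ beyond c e by apply: contra npe; apply: beyond_port.
  rewrite connect_negate_ports -/(port e) (negPf We) (negPf npe) orbF /=.
  have [ef|] := boolP (connect _ e f); rewrite ?andbF //.
  rewrite andbT [false == _]eq_sym eqbF_neg.
  apply: contra npe => /beyond_port; rewrite /port !(same_connect_r (@csym _) ef) //.
have same_set e : on_closed s e ->
    [set f | connect (joined (negate c s)) e f] = [set f | connect (joined s) e f].
  by move=> cle; apply/setP=> f; rewrite !inE same.
rewrite !cl; have [Mrb|Mrb] := eqVneq (M r) b; last first.
  rewrite addn0; congr #|pred_of_set _|; apply/setP=> K; apply/imsetP/imsetP.
    move=> [e]; rewrite -[_ \in _]/(on_closed _ _).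
    rewrite on_closed_negate (negPf Mrb) orbF => cle ->.
    by exists e; rewrite ?same_set.
  case=> e cle ->; exists e; rewrite ?same_set //.
  by rewrite -[_ \in _]/(on_closed _ e) on_closed_negate [on_closed s e]cle.
case: sM => mM cM.
have cup_port f : port f = connect (joined s) (bedge r) f.
  apply/idP/idP => [/orP[]|rf]; [by []| |by rewrite /port rf]; apply: connect_trans.
  by rewrite cM Mrb eqxx orbT.
(* The new loop is what is left of the arc from [r] to [b]; it contains the top end of [c]. *)
pose L := [set f | ~~ beyond c f && connect (joined s) (bedge r) f].
have L_class e : e \in L -> [set f | connect (joined (negate c s)) e f] = L.
  rewrite inE => /andP[We re]; apply/setP=> f.
  rewrite !inE connect_negate_ports -/(port e) -/(port f) !cup_port re (negPf We) /=.
  by rewrite [false == _]eq_sym eqbF_neg -(same_connect (@csym _) re) orbb.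
have top_L : top_end c \in L.
  rewrite inE; apply/andP; split; first by rewrite /= ltnn.
  apply: connect_trans connect_rport _; rewrite csym.
  exact/connect_right/(fresh_at fr).
rewrite (_ : [set _ | e in on_closed (negate c s)] =
  L |: [set [set f | connect (joined s) e f] | e in on_closed s]).
  rewrite cardsU1 addnC; congr (_ + nat_of_bool _).
  apply/imsetP=> -[e cle EL]; have : e \in L by rewrite EL inE connect0.
  rewrite inE => /andP[_ re]; move: (not_port e cle).
  by rewrite cup_port re.
apply/setP=> K; rewrite inE in_set1; apply/imsetP/orP.
  case=> e; rewrite -[_ \in _]/(on_closed _ _) on_closed_negate Mrb eqxx /=.
  case/orP=> [cle|eL] ->.
    by right; apply/imsetP; exists e; rewrite ?same_set.
  by left; rewrite L_class ?inE.
case=> [/eqP->|/imsetP[e cle ->]].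
  exists (top_end c); last by rewrite L_class.
  rewrite -[_ \in _]/(on_closed _ _) on_closed_negate Mrb eqxx.
  by move: top_L; rewrite inE => ->; rewrite orbT.
exists e; last by rewrite same_set.
by rewrite -[_ \in _]/(on_closed _ e) on_closed_negate [on_closed s e]cle.
Qed.

End NegatePorts.

(** * Curves as matchings, and the all-plus state *)

Definition strands s : {ffun bpoint m n -> bpoint m n} :=
  [ffun x => odflt x [pick y | (y != x) && connect (joined s) (bedge x) (bedge y)]].

(** The default in [strands] is not returned, since [M x] is always a valid pick. *)
Lemma linked_strands s M : linked s M -> strands s = M.
Proof.
case=> mM cM; apply/ffunP=> x; rewrite ffunE; case: pickP => [y|none] /=.
  by rewrite cM; case: eqP => //= _ /eqP.
by have := none (M x); rewrite cM eqxx orbT andbT; case: (mM x) => _ ->.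
Qed.

Lemma cstate_linked s M : linked s M -> cstate s = [set [set x; M x] | x : bpoint m n].
Proof.
case=> mM cM; apply/setP=> P; rewrite inE; apply/existsP/imsetP.
  case=> x /existsP[y /and3P[xy]]; rewrite cM eq_sym (negPf xy) /=.
  by move=> /eqP-> /eqP->; exists x.
case=> x _ ->; exists x; apply/existsP; exists (M x).
by rewrite cM eqxx orbT eq_sym; case: (mM x) => _ ->; rewrite eqxx.
Qed.

(** States with the same Catalan state can thus be recognised by their matchings. *)
Lemma eq_cstate s t M N : linked s M -> linked t N ->
  (cstate s == cstate t) = (M == N).
Proof.
move=> sM tN; rewrite (cstate_linked sM) (cstate_linked tN).
case: sM tN => mM _ [mN _].
apply/eqP/eqP=> [E|->//]; apply/ffunP=> x.
have : [set x; M x] \in [set [set x; N x] | x : bpoint m n].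
  by rewrite -E; apply: imset_f.
case/imsetP=> y _ /eqP; rewrite set2_eqE => /orP[]/andP[/eqP-> /eqP->] //.
by case: (mN y) => ->.
Qed.

Lemma nneg_negate c s : s c -> nneg (negate c s) = (nneg s).+1.
Proof.
move=> sc; rewrite /nneg (cardsD1 c) inE ffunE eqxx /= add1n.
congr _.+1; apply: eq_card => d; rewrite !inE ffunE.
by have [->|_] := eqVneq d c; rewrite ?sc //= .
Qed.

Definition all_plus : kstate m n := [ffun=> true].

Lemma all_plus_source e :
  exists2 x, ~~ outgoing x & connect (joined all_plus) (bedge x) e.
Proof.
have plusT d : all_plus d by rewrite ffunE.
elim/edge_ind: e => [j|i|d [x ox xd]|d [x ox xd]].
- by exists (xtop j); rewrite ?connect0.
- by exists (yleft i); rewrite ?connect0.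
- by exists x => //; apply: connect_trans xd (connect_right _).
- by exists x => //; apply: connect_trans xd (connect_bottom _).
Qed.

Lemma connect_all_plus e f :
  connect (joined all_plus) e f = (diag e == diag f).
Proof.
have plusT d : all_plus d by rewrite ffunE.
have diagE e' f' : connect (joined all_plus) e' f' -> diag e' = diag f'.
  move=> c_ef; apply: (connect_ind (P := fun g => diag e' = diag g)) c_ef _ => //.
  by move=> u v /(diag_joined plusT)->.
apply/idP/eqP => [/diagE//|E].
have [x ox xe] := all_plus_source e; have [y oy yf] := all_plus_source f.
have xy : x = y.
  by apply: diag_inj; rewrite ?(negPf ox) ?(negPf oy) // (diagE _ _ xe) E (diagE _ _ yf).
by apply: connect_trans yf; rewrite -xy connect_joined_sym.
Qed.

Lemma nclosed_all_plus : nclosed all_plus = 0.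
Proof.
apply: eq_card0 => e; rewrite !inE; apply/negP=> /andP[_].
apply/negP/on_closedP; have [x _ xe] := all_plus_source e; by exists x.
Qed.

(** Each strand joins an input to an output point: this is the trivial braid, which has no cup on
    the output side. *)
Lemma linked_all_plus :
  exists2 M, linked all_plus M & forall x, outgoing (M x) = ~~ outgoing x.
Proof.
(* The witnesses solve the equation of the [diag] values; the cases decide on which opposite side
   the strand ends. *)
have partner x : exists y, (outgoing y == ~~ outgoing x) &&
    (diag (bedge y) == diag (bedge x)).
  case: x => [[i|i]|[i|i]]; have lti := ltn_ord i.
  - have [le|lt] := ltnP (m + i) n; first by exists (xbot (Ordinal le)); rewrite /=; lia.
    have lt' : n.-1 - i < m by lia.
    by exists (yright (Ordinal lt')); rewrite /=; lia.
  - have [le|lt] := ltnP i m.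
      have lt' : m.-1 - i < m by lia.
      by exists (yleft (Ordinal lt')); rewrite /=; lia.
    have lt' : i - m < n by lia.
    by exists (xtop (Ordinal lt')); rewrite /=; lia.
  - have [le|lt] := leqP (m - i) n.
      have lt' : m.-1 - i < n by lia.
      by exists (xbot (Ordinal lt')); rewrite /=; lia.
    have lt' : n + i < m by lia.
    by exists (yright (Ordinal lt')); rewrite /=; lia.
  - have [le|lt] := leqP n i.
      have lt' : i - n < m by lia.
      by exists (yleft (Ordinal lt')); rewrite /=; lia.
    have lt' : n.-1 - i < n by lia.
    by exists (xtop (Ordinal lt')); rewrite /=; lia.
have [f fP] := fin_all_exists partner.
pose M : {ffun bpoint m n -> bpoint m n} := [ffun x => f x].
have outM x : outgoing (M x) = ~~ outgoing x.
  by rewrite ffunE; case/andP: (fP x) => /eqP.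
have diagM x : diag (bedge (M x)) = diag (bedge x).
  by rewrite ffunE; case/andP: (fP x) => _ /eqP.
exists M => //; split=> [x|x y].
  split; first by apply: diag_inj; rewrite ?diagM // !outM negbK.
  by apply/eqP=> Mx; have := outM x; rewrite Mx; case: (outgoing x).
rewrite connect_all_plus; apply/eqP/orP => [E|[]/eqP-> //].
have [o|o] := eqVneq (outgoing y) (outgoing x).
  by left; apply/eqP/diag_inj.
right; apply/eqP/diag_inj; last by rewrite diagM.
by rewrite outM; move: o; case: (outgoing x); case: (outgoing y).
Qed.

End Lattice.

(** * The state sum *)

Arguments all_plus {m n}.

Section States.
Variables m n : nat.
Implicit Types (s : kstate m n) (c d : 'I_m * 'I_n) (cs : seq ('I_m * 'I_n)).

(** The same branching as in [outcomes], so that the two lists correspond term by term. *)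
Definition states cs : seq (kstate m n) :=
  foldl (fun S c => branch (negate c) S) [:: all_plus] cs.

Lemma states_rcons cs c :
  states (rcons cs c) = states cs ++ [seq negate c s | s <- states cs].
Proof. by rewrite /states foldl_rcons. Qed.

Lemma mem_states cs s : (s \in states cs) = [forall d, (d \in cs) || s d].
Proof.
elim/last_ind: cs s => [|cs c IHcs] s.
  rewrite inE; apply/eqP/forallP => [-> d|sT]; first by rewrite ffunE orbT.
  by apply/ffunP=> d; rewrite ffunE; have := sT d.
rewrite states_rcons mem_cat IHcs; apply/orP/forallP => [[/forallP sT d|]|sT].
- by have := sT d; rewrite mem_rcons inE -orbA => ->; rewrite orbT.
- case/mapP=> t; rewrite IHcs => /forallP tT -> d.
  by rewrite mem_rcons inE ffunE; have [//|_] := eqVneq d c; apply: tT.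
have [sc|sc] := boolP (s c).
  left; apply/forallP=> d; have := sT d; rewrite mem_rcons inE.
  by have [->|//] := eqVneq d c; rewrite sc !orbT.
(* The preimage has [c] marked +1 again. *)
right; apply/mapP; exists [ffun d => (d == c) || s d].
  rewrite IHcs; apply/forallP=> d; have := sT d.
  by rewrite mem_rcons inE ffunE -orbA orbCA.
apply/ffunP=> d; rewrite !ffunE; have [->|//] := eqVneq d c.
by rewrite (negPf sc).
Qed.

Lemma uniq_states cs : uniq cs -> uniq (states cs).
Proof.
elim/last_ind: cs => [//|cs c IHcs]; rewrite rcons_uniq => /andP[c_cs /IHcs us].
have at_c s : s \in states cs -> s c.
  by rewrite mem_states => /forallP/(_ c); rewrite (negPf c_cs).
rewrite states_rcons cat_uniq us map_inj_in_uniq ?us ?andbT /=.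
  apply/hasPn=> _ /mapP[s _ ->]; apply/negP=> /at_c.
  by rewrite ffunE eqxx.
move=> s t /at_c sc /at_c tc /ffunP E; apply/ffunP=> d.
by have := E d; rewrite !ffunE; have [->|] := eqVneq d c; rewrite ?sc ?tc.
Qed.

(** The truncated subtraction is exact, because a state never has more loops than markers -1. *)
Definition observe s : outcome (bpoint m n) :=
  (strands s, nneg s - nclosed s, nclosed s).

Definition ports c := (rport c, bport c).

Definition sweep : rel ('I_m * 'I_n) := fun c d => c.1 + c.2 <= d.1 + d.2.

Lemma fresh_states cs c t : c \notin cs -> all (sweep^~ c) cs ->
  t \in states cs -> fresh t c.
Proof.
move=> c_cs c_last; rewrite mem_states => /forallP tT d td.
have d_cs : d \in cs by have := tT d; rewrite (negPf td) orbF.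
apply/andP; split; first by apply: contraNneq c_cs => <-.
exact: (allP c_last).
Qed.

Lemma linked_states cs s : uniq cs -> pairwise sweep cs -> s \in states cs ->
  linked s (strands s) /\ nclosed s <= nneg s.
Proof.
elim/last_ind: cs s => [|cs c IHcs] s.
  rewrite inE => _ _ /eqP->; rewrite nclosed_all_plus; split=> //.
  by have [M sM _] := @linked_all_plus m n; rewrite (linked_strands sM).
rewrite rcons_uniq pairwise_rcons => /andP[c_cs us] /andP[c_last sw].
rewrite states_rcons mem_cat => /orP[/IHcs|/mapP[t tcs ->]]; first exact.
have [tM le_t] := IHcs t us sw tcs.
have fr := fresh_states c_cs c_last tcs.
have t'M := linked_negate fr tM; rewrite (linked_strands t'M); split=> //.
rewrite (nclosed_negate fr tM) (nneg_negate (fresh_at fr)).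
by rewrite -addn1 leq_add // leq_b1.
Qed.

(** Sweeping by antidiagonals keeps each new crossing fresh, so negating it acts as one
    Temperley-Lieb letter at its ports. *)
Lemma observe_states cs : uniq cs -> pairwise sweep cs ->
  map observe (states cs) = outcomes (strands all_plus) (map ports cs).
Proof.
elim/last_ind: cs => [|cs c IHcs].
  rewrite /= /observe nclosed_all_plus /nneg subn0.
  by rewrite eq_card0 // => d; rewrite !inE ffunE.
rewrite rcons_uniq pairwise_rcons => /andP[c_cs us] /andP[c_last sw].
rewrite states_rcons map_rcons outcomes_rcons map_cat -IHcs //; congr (_ ++ _).
rewrite -!map_comp; apply/eq_in_map => t tcs /=.
have [tM le_t] := linked_states us sw tcs.
have fr := fresh_states c_cs c_last tcs.
rewrite /observe /step /= (linked_strands (linked_negate fr tM)).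
rewrite (nclosed_negate fr tM) (nneg_negate (fresh_at fr)).
case: eqP => [cup|_]; last by rewrite addn0 subSn.
rewrite addn1 subSS -cup reconnect_id //; by case: tM.
Qed.

Lemma letter_ports c : letter (@outgoing m n) (ports c).
Proof. by rewrite /letter rport_neq_bport outgoing_rport outgoing_bport. Qed.

Definition crossings : seq ('I_m * 'I_n) := sort sweep (enum {: 'I_m * 'I_n}).

Lemma uniq_crossings : uniq crossings.
Proof. by rewrite sort_uniq enum_uniq. Qed.

Lemma pairwise_crossings : pairwise sweep crossings.
Proof.
rewrite -sorted_pairwise; first by apply: sort_sorted => c d; apply: leq_total.
by move=> c d e; apply: leq_trans.
Qed.

Lemma perm_states : perm_eq (index_enum (kstate m n)) (states crossings).
Proof.
apply: uniq_perm; rewrite ?index_enum_uniq ?uniq_states ?uniq_crossings //.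
move=> s; rewrite mem_index_enum mem_states; apply/esym/forallP=> d.
by rewrite mem_sort mem_enum.
Qed.

Lemma linked_strandsT s : linked s (strands s) /\ nclosed s <= nneg s.
Proof.
apply: (linked_states uniq_crossings pairwise_crossings).
by rewrite -(perm_mem perm_states) mem_index_enum.
Qed.

Local Open Scope ring_scope.

Lemma signed_state_count_gt0 s :
  (forall t, strands t = strands s ->
    (nneg s - nclosed s <= nneg t - nclosed t)%N) ->
  0 < \sum_(t : kstate m n | (strands t == strands s) &&
        (nneg t - nclosed t == nneg s - nclosed s)%N) (-1) ^+ nclosed t :> int.
Proof.
move=> s_min; rewrite (perm_big _ perm_states) /=.
have [M plusM outM] := @linked_all_plus m n.
have EM := linked_strands plusM.
have obs := observe_states uniq_crossings pairwise_crossings; rewrite EM in obs.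
have := @signed_count_gt0 _ M (@outgoing m n)
  (proj1 plusM) _ (map ports crossings) (observe s).
rewrite /signed_count -obs big_map; apply.
- by move=> x y ox oy; apply: contraTneq oy => <-; rewrite outM ox.
- by apply/allP=> _ /mapP[c _ ->]; apply: letter_ports.
- by apply: map_f; rewrite -(perm_mem perm_states) mem_index_enum.
- by move=> _ /mapP[t _ ->] /= /s_min.
Qed.

End States.

(** * The leading coefficient of the state sum *)

Local Open Scope ring_scope.

(** The polynomial has degree 4k and leading coefficient (-1)^k. *)
Lemma coef_loop_factor (i k : nat) : (4 * k <= i)%N ->
  ((- ('X^4 + 1)) ^+ k)`_i = (if i == (4 * k)%N then (-1) ^+ k else 0) :> int.
Proof.
move=> le_ki; set p : {poly int} := 'X^4 + 1.
have size_p : size p = 5 by rewrite /p -polyC1 size_XnaddC.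
have size_pk : size (p ^+ k) = (4 * k).+1.
  have p0 : p ^+ k != 0 by rewrite expf_neq0 // -size_poly_eq0 size_p.
  have := size_exp p k; rewrite size_p -size_poly_gt0 in p0 * => /= <-.
  by rewrite prednK.
have lead_p : lead_coef p = 1 by rewrite /p -polyC1 lead_coefXnaddC.
have lead_pk : lead_coef (p ^+ k) = 1 by rewrite lead_coef_exp lead_p expr1n.
have -> : (- p) ^+ k = ((-1) ^+ k)%:P * p ^+ k.
  by rewrite polyC_exp polyCN polyC1 -exprNn.
rewrite coefCM.
case: eqP => [->|/eqP ne].
  by move: lead_pk; rewrite lead_coefE size_pk /= => ->; rewrite mulr1.
by rewrite nth_default ?mulr0 // size_pk ltn_neqAle eq_sym ne.
Qed.

Lemma npos_nneg m n (s : kstate m n) : (npos s + nneg s = m * n)%N.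
Proof.
rewrite /npos /nneg -[RHS](_ : #|{: 'I_m * 'I_n}| = _).
  by rewrite -(cardC [set c | s c]); congr (_ + _)%N; apply: eq_card => c; rewrite !inE.
by rewrite card_prod !card_ord.
Qed.

Lemma Avar_neq0 : Avar != 0.
Proof. by rewrite tofrac_eq0 polyX_eq0. Qed.

(** The lowest exponent in a term is at least -3mn, so A^(3mn) clears all denominators; A^-2 is
    taken out of each loop factor. The truncated subtractions are exact, and the term has degree 4mn
    - 2d. *)
Lemma state_term_frac m n (s : kstate m n) : (nclosed s <= nneg s)%N ->
  let d := (nneg s - nclosed s)%N in
  Avar ^+ (3 * (m * n)) * (Avar ^ ((npos s)%:Z - (nneg s)%:Z)
      * (- Avar ^+ 2 - Avar ^- 2) ^+ nclosed s) =
  tofrac ('X^(4 * (m * n) - 2 * d - 4 * nclosed s) *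
          (- ('X^4 + 1)) ^+ nclosed s).
Proof.
move=> le_k /=; have A0 := Avar_neq0.
have ppn := npos_nneg s; set k := nclosed s in le_k *.
rewrite rmorphM rmorphXn rmorphXn rmorphN rmorphD rmorphXn rmorph1 /= -/Avar.
rewrite mulrA exprnP -expfzDr //.
have -> : ((3 * (m * n))%N : int) + ((npos s)%:Z - (nneg s)%:Z) =
  (4 * (m * n) - 2 * (nneg s - k) - 4 * k + 2 * k)%N by lia.
rewrite -exprnP exprD -mulrA [X in _ * (X * _)]exprM -exprMn.
congr (_ * _ ^+ _); rewrite mulrDr !mulrN -exprD divff ?expf_neq0 // opprD //.
Qed.

Theorem theorem3p13 (m n : nat) (C : {set {set bpoint m n}})
    (hC : C \in Cat m n) :
  coefA C <> 0 <-> realizable C.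
Proof.
split=> [|[s1 Cs1]].
  case: (pickP (fun s : kstate m n => cstate s == C)) => [s /eqP <- _|none].
    by exists s.
  by rewrite /coefA big_pred0.
have Cs1' : cstate s1 == C by rewrite Cs1.
(* A state of [C] with minimal d gives the top degree. *)
have [s /eqP Cs s_min] := @arg_minnP _ s1 (fun s => cstate s == C)
  (fun s => nneg s - nclosed s)%N Cs1'.
have strandsE t : (cstate t == C) = (strands t == strands s).
  by rewrite -Cs (eq_cstate (proj1 (linked_strandsT t)) (proj1 (linked_strandsT s))).
set d := (nneg s - nclosed s)%N in s_min.
pose P : {poly int} := \sum_(t : kstate m n | cstate t == C)
  'X^(4 * (m * n) - 2 * (nneg t - nclosed t) - 4 * nclosed t) *
          (- ('X^4 + 1)) ^+ nclosed t.
have PE : Avar ^+ (3 * (m * n)) * coefA C = tofrac P.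
  rewrite /coefA mulr_sumr rmorph_sum; apply: eq_bigr => t _.
  by apply: state_term_frac; case: (linked_strandsT t).
suff P_neq0 : P != 0.
  move=> C0; move: PE; rewrite C0 mulr0 => /esym/eqP.
  by rewrite tofrac_eq0 (negPf P_neq0).
have d_le (t : kstate m n) : (nneg t <= m * n)%N by rewrite -(npos_nneg t) leq_addl.
apply/negP=> /eqP/(congr1 (fun p : {poly int} => p`_(4 * (m * n) - 2 * d))).
rewrite coef0 coef_sum; apply/eqP; rewrite gt_eqF //.
have := @signed_state_count_gt0 m n s.
rewrite -/d big_mkcondr /= => pos; apply: lt_le_trans (pos _) _ => [t|].
  by rewrite -/d => Et; apply: s_min; rewrite strandsE Et.
rewrite le_eqVlt; apply/orP; left; apply/eqP.
apply: eq_big => [t|t Et]; first by rewrite strandsE.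
have := s_min t; rewrite strandsE => /(_ Et) le_d.
have [_ le_k] := linked_strandsT t; have := d_le t => le_t.
rewrite coefXnM [RHS]ifN; last lia.
rewrite coef_loop_factor; last lia.
(* The index left is 4k + 2(d_t - d), with d_t and k the difference and the number of loops for [t];
   it equals 4k exactly when d_t = d. *)
congr (if _ then _ else _); lia.
Qed.
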